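(* Let $(\mathbb{R},\mathfrak{L},\mu_L)$ be the Lebesgue measure over $\mathbb{R}$, where $\mathfrak{L}$ is the $\sigma$-algebra of Lebesgue measurable sets, and let $\overline{\mu}_L$ be the Lebesgue outer measure on $\mathcal{P}(\mathbb{R})$. Then there exist a superreal field $\mathbb{F}$ and an elementary numerosity $\mathfrak{n}:\mathcal{P}(\mathbb{R})\to[0,+\infty)_{\mathbb{F}}$ such that: (1) $\mathfrak{n}([x,x+a))=\mathfrak{n}([y,y+a))$ for all $x,y\in\mathbb{R}$ and for all real $a>0$; (2) $\mathfrak{n}([x,x+a))=a\cdot\mathfrak{n}([0,1))$ for all $x\in\mathbb{R}$ and all rational numbers $a>0$; (3) $\text{sh}\left(\frac{\mathfrak{n}(X)}{\mathfrak{n}([0,1))}\right)=\mu_L(X)$ for all $X\in\mathfrak{L}$; (4) $\text{sh}\left(\frac{\mathfrak{n}(X)}{\mathfrak{n}([0,1))}\right)\le\overline{\mu}_L(X)$ for all $X\subseteq\mathbb{R}$.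
   Context: A superreal field is an ordered field $\mathbb{F}\supseteq\mathbb{R}$ extending the ordered field of real numbers; $[0,+\infty)_{\mathbb{F}}=\{x\in\mathbb{F}\mid x\ge 0\}$. An element $\xi\in\mathbb{F}$ is finite if $-n<\xi<n$ for some positive integer $n$, and infinite otherwise. For finite $\xi\in\mathbb{F}$, the shadow $\text{sh}(\xi)$ is the unique real number $r$ such that $-1/n<\xi-r<1/n$ for all positive integers $n$; for infinite $\xi$ one puts $\text{sh}(\xi)=+\infty$ if $\xi>0$ and $\text{sh}(\xi)=-\infty$ if $\xi<0$. An elementary numerosity on a set $\Omega$ is a function $\mathfrak{n}:\mathcal{P}(\Omega)\to[0,+\infty)_{\mathbb{F}}$, defined on all subsets of $\Omega$ with values in the non-negative part of a superreal field $\mathbb{F}$, such that $\mathfrak{n}(\{x\})=1$ for every $x\in\Omega$ and $\mathfrak{n}(A\cup B)=\mathfrak{n}(A)+\mathfrak{n}(B)$ whenever $A,B$ are disjoint. *)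

(* Defs.v *)
From HB Require Import structures.
From mathcomp Require Import all_boot all_order all_algebra.
From mathcomp Require Import all_classical all_reals all_analysis.

Set Implicit Arguments.
Unset Strict Implicit.
Unset Printing Implicit Defensive.

Import Order.TTheory GRing.Theory Num.Theory.
Import numFieldNormedType.Exports.

Local Open Scope classical_set_scope.
Local Open Scope ring_scope.

(* The inclusion of the reals is an explicit order embedding of fields. *)
Record superreal (R : realType) := Superreal {
  superreal_sort :> realFieldType;
  of_real : {rmorphism R -> superreal_sort};
  of_real_mono : {mono of_real : x y / x <= y}
}.

Arguments of_real {R} s.
Arguments of_real_mono {R} s.

Section shadow.
Context {R : realType} (F : superreal R).
Implicit Types xi : F.

Definition finite_elt xi : Prop :=
  exists2 n : nat, (0 < n)%N & - n%:R < xi < n%:R.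

Definition is_shadow xi (r : R) : Prop :=
  forall n : nat, (0 < n)%N -> - n%:R^-1 < xi - of_real F r < n%:R^-1.

(* For finite [xi] the default value 0 of [xget] is never used, and the value
   does not depend on the choice made by [xget]: see [is_shadow_ex] and
   [is_shadow_uniq]. *)
Definition sh xi : \bar R :=
  if `[< finite_elt xi >] then (xget 0 [set r | is_shadow xi r])%:E
  else if 0 < xi then +oo%E else -oo%E.

Lemma is_shadow_ex xi : finite_elt xi -> exists r, is_shadow xi r.
Proof.
move=> [n n0 /andP[nxi xin]].
pose E : set R := [set r | of_real F r <= xi].
have En : E (- n%:R) by rewrite /E /= rmorphN rmorph_nat ltW.
have ubE : ubound E n%:R.
  move=> r /= Er; rewrite -(of_real_mono F) rmorph_nat.
  exact: le_trans Er (ltW xin).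
have supE : has_sup E by split; [exists (- n%:R) | exists n%:R].
exists (sup E) => k k0.
have k'0 : 0 < (k%:R^-1 : R) by rewrite invr_gt0 ltr0n.
have iV : of_real F k%:R^-1 = k%:R^-1 by rewrite fmorphV rmorph_nat.
apply/andP; split.
  have [e Ee sEe] := sup_adherent k'0 supE.
  rewrite ltrBrDl -iV -rmorphB; apply: lt_le_trans Ee.
  by rewrite (leW_mono (of_real_mono F)).
rewrite ltNge -iV; apply/negP; rewrite lerBrDl -rmorphD => Ek.
have := ub_le_sup supE.2 Ek.
by rewrite gerDl leNgt k'0.
Qed.

Lemma is_shadow_uniq xi r s : is_shadow xi r -> is_shadow xi s -> r = s.
Proof.
have key (a b : R) : is_shadow xi a -> is_shadow xi b -> a <= b.
  move=> ha hb; rewrite leNgt; apply/negP => ba.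
  have d0 : 0 < a - b by rewrite subr_gt0.
  pose k := (Num.bound (2 / (a - b))).+1.
  have k0 : 0 < k%:R :> R by rewrite ltr0n.
  have kd : 2 / k%:R < a - b.
    rewrite ltr_pdivrMr// mulrC -ltr_pdivrMr//.
    apply: lt_trans (_ : (Num.bound (2 / (a - b)))%:R < _); last first.
      by rewrite ltr_nat.
    by apply: archi_boundP; rewrite divr_ge0// ltW.
  have /andP[+ _] := ha k isT; have /andP[_] := hb k isT.
  rewrite ltrBlDl ltrNl opprB ltrBlDl => xb axi.
  have : of_real F a < of_real F (b + k%:R^-1 + k%:R^-1).
    rewrite !rmorphD !fmorphV !rmorph_nat.
    by rewrite (lt_trans axi)// ltrD2r.
  rewrite (leW_mono (of_real_mono F)) -addrA => aa.
  suff : a < a by rewrite ltxx.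
  rewrite (lt_trans aa)// -ltrBrDl; apply: le_lt_trans kd.
  by rewrite mulrDl mul1r.
by move=> hr hs; apply/eqP; rewrite eq_le !key.
Qed.

End shadow.

Record elementary_numerosity (R : realType) (F : superreal R) (Omega : Type)
    (nu : set Omega -> F) : Prop := ElementaryNumerosity {
  numerosity_ge0 : forall A, 0 <= nu A;
  numerosity_set1 : forall x, nu [set x] = 1;
  numerosityU : forall A B, A `&` B = set0 -> nu (A `|` B) = nu A + nu B
}.

Section lebesgue.
Context {R : realType}.

(* [wlength idfun] is the length function on the semiring of intervals ]a, b];
   its outer measure is the usual one obtained from countable covers by
   intervals, and [completed_lebesgue_measure] is a measure on the sigma-algebra
   of its Caratheodory measurable sets, i.e. the completion of the Borel sets
   for [lebesgue_measure] (completed_caratheodory_measurable). *)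
Definition lebesgue_outer_measure : set R -> \bar R :=
  (wlength (idfun : R -> R))^*%mu.

Definition lebesgue_measurable : set (set R) :=
  (wlength (idfun : R -> R))^*%mu.-cara.-measurable.

End lebesgue.

(* Main.v *)
Require Import Defs.
From HB Require Import structures.
From mathcomp Require Import all_boot all_order all_algebra.
From mathcomp Require Import all_classical all_reals all_analysis.

Import Order.TTheory GRing.Theory Num.Theory.
Import numFieldNormedType.Exports.

Local Open Scope classical_set_scope.
Local Open Scope ring_scope.

(** The numerosity is a limit, along an ultrafilter, of finitely additive real
    set functions that satisfy more and more of the requirements; the field is
    the corresponding ultrapower of [R], so that whatever holds at eventually
    every stage holds exactly in the limit.

    A stage [i] consists of a finite list [s] of sets, a finite list [p] of
    reals and a precision [n]. The stages are directed, so some ultrafilter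
    makes every set, every real and every precision eventually available. It
    remains to find, for one stage, a finitely additive [nu >= 0] on all sets
    and a large constant [K] such that [nu [set x] = 1] for [x] in [p], [nu]
    of [a, b) is exactly [K (b - a)] for [a], [b] in [p], and [nu X / K] is
    within [1/(n+1)] of the Lebesgue measure of [X], cut down to a large
    bounded window, for each measurable [X] in [s]; the singletons and the
    intervals are also taken from [s] ([approximate_numerosity]).

    As a stage may take any values in [R], masses need not be integers: start
    from [K] times Lebesgue measure, add a unit mass at each point [e] of [p],
    and restore the measure of the intervals by removing a mass 1 spread
    uniformly over [e, e + h), where [h] is at most every gap in [p]. No
    interval with endpoints in [p] separates [e] from [e, e + h), hence the
    exactness; for [K] large the result is nonnegative and the perturbation,
    which changes no set by more than the size of [p], is negligible after
    division by [K]. To get a value on every set, pull back along a map [c]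
    sending each point to a fixed representative of its atom in the algebra
    generated by the measurable members of [s]: each preimage by [c] is a
    finite union of atoms, and each measurable member of [s] is its own
    preimage ([representative_map]).

    In the limit, interval lengths are respected exactly. Monotonicity and a
    measurable superset of nearly the same measure bound the shadow of the
    ratio by the outer measure; the window tends to the line, so for
    measurable sets that shadow is also at least the measure. *)

(** * The ultrapower of the reals *)

Section ultrapower.
Local Open Scope quotient_scope.
Context {R : realType} {I : Type} (U : set_system I) {UU : UltraFilter U}.
Implicit Types f g : I -> R.

Definition ae_eq f g : bool := `[< \forall i \near U, f i = g i >].

Lemma ae_eq_refl : reflexive ae_eq.
Proof. by move=> f; apply/asboolP; near=> i. Unshelve. all: by end_near. Qed.

Lemma ae_eq_sym : symmetric ae_eq.
Proof.
by move=> f g; apply/asboolP/asboolP; apply: filterS.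
Qed.

Lemma ae_eq_trans : transitive ae_eq.
Proof.
move=> g f h /asboolP fg /asboolP gh; apply/asboolP.
by apply: filterS2 fg gh => i ->.
Qed.

Canonical ae_eq_equiv := EquivRel ae_eq ae_eq_refl ae_eq_sym ae_eq_trans.

Definition hyper := {eq_quot ae_eq}.
HB.instance Definition _ := Choice.on hyper.

(** All computations go through [hclass], whose equality is equality almost
    everywhere; the representatives chosen by [repr] only serve to define the
    operations. *)
Definition hclass f : hyper := \pi_({eq_quot ae_eq}) f.

Lemma hclass_eq f g : hclass f = hclass g <-> \forall i \near U, f i = g i.
Proof. by split => [/eqmodP/asboolP|?]//; apply/eqmodP/asboolP. Qed.

Lemma hclassP (x : hyper) : exists f, x = hclass f.
Proof. by exists (repr x); rewrite /hclass reprK. Qed.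

Lemma hclass_repr f : \forall i \near U, repr (hclass f) i = f i.
Proof. by apply/hclass_eq; rewrite /hclass reprK. Qed.

Definition hyper1 (op : R -> R) (x : hyper) : hyper := hclass (op \o repr x).
Definition hyper2 (op : R -> R -> R) (x y : hyper) : hyper :=
  hclass (fun i => op (repr x i) (repr y i)).

Lemma hyper1E op f : hyper1 op (hclass f) = hclass (op \o f).
Proof.
by apply/hclass_eq; have := hclass_repr f; apply: filterS => i /= ->.
Qed.

Lemma hyper2E op f g :
  hyper2 op (hclass f) (hclass g) = hclass (fun i => op (f i) (g i)).
Proof.
apply/hclass_eq; have := hclass_repr g; have := hclass_repr f.
by apply: filterS2 => i -> ->.
Qed.

Definition hconst (r : R) := hclass (fun=> r).

Let hE := (hyper1E, hyper2E).

Fact hyper_addA : associative (hyper2 +%R).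
Proof.
move=> x y z.
have [[[f ->] [g ->]] [h ->]] := (hclassP x, hclassP y, hclassP z).
by rewrite !hE; congr hclass; apply/funext => i; rewrite addrA.
Qed.

Fact hyper_addC : commutative (hyper2 +%R).
Proof.
move=> x y; have [[f ->] [g ->]] := (hclassP x, hclassP y).
by rewrite !hE; congr hclass; apply/funext => i; rewrite addrC.
Qed.

Fact hyper_add0 : left_id (hconst 0) (hyper2 +%R).
Proof.
move=> x; have [f ->] := hclassP x.
by rewrite !hE; congr hclass; apply/funext => i; rewrite add0r.
Qed.

Fact hyper_addN : left_inverse (hconst 0) (hyper1 -%R) (hyper2 +%R).
Proof.
move=> x; have [f ->] := hclassP x.
by rewrite !hE; congr hclass; apply/funext => i /=; rewrite addNr.
Qed.

HB.instance Definition _ := GRing.isZmodule.Build hyper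
  hyper_addA hyper_addC hyper_add0 hyper_addN.

Fact hyper_mulA : associative (hyper2 *%R).
Proof.
move=> x y z.
have [[[f ->] [g ->]] [h ->]] := (hclassP x, hclassP y, hclassP z).
by rewrite !hE; congr hclass; apply/funext => i; rewrite mulrA.
Qed.

Fact hyper_mulC : commutative (hyper2 *%R).
Proof.
move=> x y; have [[f ->] [g ->]] := (hclassP x, hclassP y).
by rewrite !hE; congr hclass; apply/funext => i; rewrite mulrC.
Qed.

Fact hyper_mul1 : left_id (hconst 1) (hyper2 *%R).
Proof.
move=> x; have [f ->] := hclassP x.
by rewrite !hE; congr hclass; apply/funext => i; rewrite mul1r.
Qed.

Fact hyper_mulDl : left_distributive (hyper2 *%R) (hyper2 +%R).
Proof.
move=> x y z.
have [[[f ->] [g ->]] [h ->]] := (hclassP x, hclassP y, hclassP z).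
by rewrite !hE; congr hclass; apply/funext => i; rewrite mulrDl.
Qed.

Fact hyper_oner_neq0 : hconst 1 != hconst 0.
Proof.
apply/eqP => /hclass_eq/filter_ex[i /eqP].
by rewrite oner_eq0.
Qed.

HB.instance Definition _ := GRing.Zmodule_isComNzRing.Build hyper
  hyper_mulA hyper_mulC hyper_mul1 hyper_mulDl hyper_oner_neq0.

Lemma hclassD f g : hclass f + hclass g = hclass (fun i => f i + g i).
Proof. exact: hyper2E. Qed.
Lemma hclassM f g : hclass f * hclass g = hclass (fun i => f i * g i).
Proof. exact: hyper2E. Qed.
Lemma hclassN f : - hclass f = hclass (fun i => - f i).
Proof. exact: hyper1E. Qed.

Lemma hclassB f g : hclass f - hclass g = hclass (fun i => f i - g i).
Proof. by rewrite hclassN hclassD. Qed.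

(** The ultrafilter dichotomy enters here and in [hyper_le0_total]: a class
    that is not null is represented by a function nonzero almost everywhere. *)
Fact hyper_mulVf (x : hyper) : x != 0 -> hyper1 GRing.inv x * x = 1.
Proof.
have [f ->] := hclassP x => /eqP f0; rewrite hyper1E hclassM.
apply/hclass_eq.
have [f0U|] := in_ultra_setVsetC [set i | f i = 0] UU.
  by exfalso; apply: f0; apply/hclass_eq.
by apply: filterS => i /= /eqP fi0; rewrite mulVf.
Qed.

Fact hyper_invr0 : hyper1 GRing.inv (0 : hyper) = 0.
Proof.
by rewrite hyper1E; apply/hclass_eq; near=> i; rewrite /= invr0.
Unshelve. all: by end_near. Qed.

HB.instance Definition _ := GRing.ComNzRing_isField.Build hyper
  hyper_mulVf hyper_invr0.

Lemma hclassV f : (hclass f)^-1 = hclass (fun i => (f i)^-1).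
Proof. exact: hyper1E. Qed.

Definition hyper_le (x y : hyper) : bool :=
  `[< \forall i \near U, repr x i <= repr y i >].
Definition hyper_norm (x : hyper) : hyper := hyper1 Num.norm x.

Lemma hyper_leP f g :
  reflect (\forall i \near U, f i <= g i) (hyper_le (hclass f) (hclass g)).
Proof.
apply: (iffP (asboolP _)); have := hclass_repr g; have := hclass_repr f;
  by apply: filterS3 => i -> ->.
Qed.

Fact hyper_le0_add (x y : hyper) :
  hyper_le 0 x -> hyper_le 0 y -> hyper_le 0 (x + y).
Proof.
have [[f ->] [g ->]] := (hclassP x, hclassP y).
move=> /hyper_leP f0 /hyper_leP g0; rewrite hclassD; apply/hyper_leP.
by apply: filterS2 f0 g0 => i; exact: addr_ge0.
Qed.

Fact hyper_le0_mul (x y : hyper) :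
  hyper_le 0 x -> hyper_le 0 y -> hyper_le 0 (x * y).
Proof.
have [[f ->] [g ->]] := (hclassP x, hclassP y).
move=> /hyper_leP f0 /hyper_leP g0; rewrite hclassM; apply/hyper_leP.
by apply: filterS2 f0 g0 => i; exact: mulr_ge0.
Qed.

Fact hyper_le0_anti (x : hyper) : hyper_le 0 x -> hyper_le x 0 -> x = 0.
Proof.
have [f ->] := hclassP x => /hyper_leP f0 /hyper_leP f0'.
by apply/hclass_eq; apply: filterS2 f0 f0' => i ? ?; apply/le_anti/andP.
Qed.

Fact hyper_sub_ge0 (x y : hyper) : hyper_le 0 (y - x) = hyper_le x y.
Proof.
have [[f ->] [g ->]] := (hclassP x, hclassP y).
rewrite hclassB; apply/hyper_leP/hyper_leP; apply: filterS => i;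
  by rewrite subr_ge0.
Qed.

Fact hyper_le0_total (x : hyper) : hyper_le 0 x || hyper_le x 0.
Proof.
have [f ->] := hclassP x.
have [f0|f0] := in_ultra_setVsetC [set i | 0 <= f i] UU; apply/orP.
  by left; apply/hyper_leP.
right; apply/hyper_leP; apply: filterS f0 => i /= /negP.
by rewrite -ltNge => /ltW.
Qed.

Fact hyper_normN (x : hyper) : hyper_norm (- x) = hyper_norm x.
Proof.
have [f ->] := hclassP x; rewrite hclassN /hyper_norm !hyper1E.
by congr hclass; apply/funext => i /=; rewrite normrN.
Qed.

Fact hyper_ge0_norm (x : hyper) : hyper_le 0 x -> hyper_norm x = x.
Proof.
have [f ->] := hclassP x => /hyper_leP f0; rewrite /hyper_norm hyper1E.
by apply/hclass_eq; apply: filterS f0 => i /= /ger0_norm.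
Qed.

HB.instance Definition _ := Num.IntegralDomain_isLeReal.Build hyper
  hyper_le0_add hyper_le0_mul hyper_le0_anti hyper_sub_ge0 hyper_le0_total
  hyper_normN hyper_ge0_norm (fun _ _ => erefl).

Lemma hclass_le f g :
  reflect (\forall i \near U, f i <= g i) (hclass f <= hclass g).
Proof. exact: hyper_leP. Qed.

Fact hconst_is_zmod_morphism : zmod_morphism hconst.
Proof. by move=> r s; rewrite hclassB. Qed.

Fact hconst_is_monoid_morphism : monoid_morphism hconst.
Proof. by split => // r s; rewrite hclassM. Qed.

HB.instance Definition _ := GRing.isZmodMorphism.Build R hyper hconst
  hconst_is_zmod_morphism.
HB.instance Definition _ := GRing.isMonoidMorphism.Build R hyper hconst
  hconst_is_monoid_morphism.

Lemma hconst_mono : {mono hconst : r s / r <= s}.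
Proof.
move=> r s; apply/hclass_le/idP => [/filter_ex[]//|rs]; exact: nearW.
Qed.

Definition hyper_superreal : superreal R :=
  @Superreal R hyper hconst hconst_mono.

End ultrapower.

(** * Lebesgue measure seen through a bounded window *)

Section window.
Context {R : realType}.
Implicit Types (A B : set R) (N a b : R).

Local Notation lambda := (@completed_lebesgue_measure R).
Local Notation cara := (caratheodory_type (wlength (idfun : R -> R))^*%mu).

Lemma lebesgue_measurable0 : lebesgue_measurable (set0 : set R).
Proof. exact: (@measurable0 _ cara). Qed.

Lemma lebesgue_measurableT : lebesgue_measurable (setT : set R).
Proof. exact: (@measurableT _ cara). Qed.

Lemma lebesgue_measurableC A :
  lebesgue_measurable A -> lebesgue_measurable (~` A).
Proof. exact: (@measurableC _ cara). Qed.

Lemma lebesgue_measurableI A B :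
  lebesgue_measurable A -> lebesgue_measurable B ->
  lebesgue_measurable (A `&` B).
Proof. exact: (@measurableI _ cara). Qed.

Lemma lebesgue_measurableU A B :
  lebesgue_measurable A -> lebesgue_measurable B ->
  lebesgue_measurable (A `|` B).
Proof. exact: (@measurableU _ cara). Qed.

Lemma lebesgue_measurable_borel A :
  @measurable _ (measurableTypeR R) A -> lebesgue_measurable A.
Proof. exact: sub_caratheodory. Qed.

Lemma lebesgue_measurable_itv (i : interval R) :
  lebesgue_measurable [set` i].
Proof. exact: lebesgue_measurable_borel. Qed.

Lemma lebesgue_measurable_set1 (x : R) : lebesgue_measurable [set x].
Proof. exact: lebesgue_measurable_borel. Qed.

Lemma completed_lebesgue_itv a b : a <= b ->
  lambda `[a, b[%classic = (b - a)%:E.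
Proof.
move=> ab; have := lebesgue_measure_itv `[a, b[.
rewrite /= lte_fin => h; rewrite -[LHS]/(lebesgue_measure `[a, b[%classic) h.
by move: ab; rewrite le_eqVlt => /orP[/eqP ->|->]//; rewrite ltxx subrr.
Qed.

Lemma completed_lebesgue_set1 (x : R) : lambda [set x] = 0%E.
Proof. exact: (@lebesgue_measure_set1 R x). Qed.

Lemma le_completed_lebesgue A B : A `<=` B -> (lambda A <= lambda B)%E.
Proof.
by move=> AB; exact: (@le_mu_ext _ _ _ (wlength (idfun : R -> R)) A B AB).
Qed.

(** Cutting down to a bounded window makes every measure finite, so that sums
    and differences can be taken in [R]. *)
Definition window N A : R := fine (lambda (A `&` `[- N, N[%classic)).

Lemma fin_num_window N A : lambda (A `&` `[- N, N[%classic) \is a fin_num.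
Proof.
rewrite ge0_fin_numE//.
have h : (lambda `[(- N)%R, N[%classic < +oo)%E.
  have [NN|NN] := leP (- N) N; first by rewrite completed_lebesgue_itv// ltry.
  by rewrite set_itv_ge ?measure0// bnd_simp -leNgt ltW.
by apply: le_lt_trans h; apply: le_completed_lebesgue => x [].
Qed.

Lemma window_ge0 N A : 0 <= window N A.
Proof. exact/fine_ge0/measure_ge0. Qed.

Lemma le_window N A B : A `<=` B -> window N A <= window N B.
Proof.
move=> AB; apply: fine_le; rewrite ?fin_num_window//.
by apply: le_completed_lebesgue; exact: setSI.
Qed.

Lemma windowU N A B : lebesgue_measurable A -> lebesgue_measurable B ->
  A `&` B = set0 -> window N (A `|` B) = window N A + window N B.
Proof.
move=> mA mB AB0; rewrite /window -fineD ?fin_num_window// setIUl.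
congr fine.
apply: (@measureU _ cara _ lambda);
  try exact: lebesgue_measurableI (lebesgue_measurable_itv _).
by rewrite setIACA AB0 set0I.
Qed.

Lemma window_set1 N (x : R) : window N [set x] = 0.
Proof.
apply/eqP; rewrite eq_le window_ge0 andbT.
rewrite -lee_fin fineK ?fin_num_window//.
apply: (@le_trans _ _ (lambda [set x])).
  2: by rewrite completed_lebesgue_set1.
by apply: le_completed_lebesgue => y [].
Qed.

Lemma window0 N : window N set0 = 0.
Proof. by rewrite /window set0I (@measure0 _ cara _ lambda). Qed.

Lemma le_window_itv N a b : a <= b -> window N `[a, b[%classic <= b - a.
Proof.
move=> ab; rewrite -lee_fin fineK ?fin_num_window// -completed_lebesgue_itv//.
by apply: le_completed_lebesgue => y [].
Qed.

Lemma window_itv N a b : a <= b -> - N <= a -> b <= N ->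
  window N `[a, b[%classic = b - a.
Proof.
move=> ab Na bN; rewrite /window setIidl.
  by rewrite completed_lebesgue_itv.
move=> x /=; rewrite !in_itv/= => /andP[ax xb].
by rewrite (le_trans Na ax) (lt_le_trans xb bN).
Qed.

End window.

(** * A real-valued numerosity for finitely many constraints *)

Section finite_approximation.
Context {R : realType}.
Implicit Types (X Y : set R) (s : seq (set R)) (p : seq R).

(** The fibres of [pattern s] are the atoms of the algebra generated by [s]. *)
Definition pattern s (x : R) : seq bool := [seq x \in X | X <- s].

(** A union of atoms splits along the first set of the list into two unions of
    atoms for the remaining sets. *)
Lemma lebesgue_measurable_pattern s (P : set (seq bool)) :
  (forall X, X \in s -> lebesgue_measurable X) ->
  lebesgue_measurable (pattern s @^-1` P).
Proof.
elim: s P => [P _|X s IH P ms].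
  have [P0|nP0] := pselect (P [::]).
    rewrite (_ : _ @^-1` _ = setT); first exact: lebesgue_measurableT.
    by apply/seteqP; split.
  rewrite (_ : _ @^-1` _ = set0); first exact: lebesgue_measurable0.
  by apply/seteqP; split.
have mX : lebesgue_measurable X by apply: ms; rewrite mem_head.
have {}IH Q : lebesgue_measurable (pattern s @^-1` Q).
  by apply: IH => Y Ys; apply: ms; rewrite in_cons Ys orbT.
rewrite (_ : _ @^-1` _ =
  (X `&` pattern s @^-1` [set t | P (true :: t)]) `|`
  (~` X `&` pattern s @^-1` [set t | P (false :: t)])).
  by apply: lebesgue_measurableU; apply: lebesgue_measurableI => //;
    exact: lebesgue_measurableC.
apply/seteqP; split => x /=.
  have [xX|xX] := pselect (X x).
    by rewrite mem_set// => ?; left.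
  by rewrite memNset// => ?; right.
by case=> -[xX]; [rewrite mem_set|rewrite memNset].
Qed.

(** Pulling a finitely additive function on measurable sets back along such a
    map extends it to all sets, without changing it on the members of [s]. *)
Lemma representative_map s : (forall X, X \in s -> lebesgue_measurable X) ->
  exists c : R -> R, (forall Y, lebesgue_measurable (c @^-1` Y)) /\
                     (forall X, X \in s -> c @^-1` X = X).
Proof.
move=> ms; pose g t := xget 0 [set x | pattern s x = t].
exists (g \o pattern s); split => [Y|X Xs].
  exact: (lebesgue_measurable_pattern s (g @^-1` Y) ms).
have gE x : pattern s (g (pattern s x)) = pattern s x.
  by rewrite /g; case: xgetP => [y _ ->|/(_ x) []].
apply/seteqP; split => x /=; have := gE x.
  move/eq_in_map => /(_ X Xs) + gX.
  by rewrite mem_set// => /esym/set_mem.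
by move/eq_in_map => /(_ X Xs) + gX; rewrite (mem_set gX) => /set_mem.
Qed.

Lemma min_gap (s : seq R) :
  exists h : R, 0 < h /\ forall x, x \in s -> 0 < x -> h <= x.
Proof.
elim: s => [|y s [h [h0 hs]]]; first by exists 1.
have [y0|y0] := ltP 0 y.
  exists (Num.min h y); split; first by rewrite lt_min h0.
  move=> x; rewrite in_cons ge_min => /orP[/eqP -> _|xs x0].
    by rewrite lexx orbT.
  by rewrite hs.
exists h; split => // x; rewrite in_cons => /orP[/eqP -> |]; last exact: hs.
by rewrite ltNge y0.
Qed.

Lemma finite_bound (s : seq R) (n : R) :
  exists N : R, n <= N /\ forall x, x \in s -> `|x| <= N.
Proof.
elim: s => [|y s [N [nN sN]]]; first by exists n.
exists (Num.max N `|y|); split; first by rewrite le_max nN.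
move=> x; rewrite in_cons le_max => /orP[/eqP ->|/sN ->//].
by rewrite lexx orbT.
Qed.

Lemma indicU_disjoint X Y (x : R) : X `&` Y = set0 ->
  \1_(X `|` Y) x = \1_X x + \1_Y x :> R.
Proof.
move=> XY0; rewrite !indicE in_setU.
case: (boolP (x \in X)) => [xX|_]; last by rewrite add0r.
rewrite memNset ?addr0// => xY.
by have : set0 x by rewrite -XY0; split => //; exact: set_mem.
Qed.

(** Moving the unit mass of [e] from the uniform distribution on [e, e + h)
    to the point [e] does not change the mass of an interval with endpoints in
    [p], because [e + h] does not pass the next point of [p].  [K] dominates
    [k / h], the largest density that is removed, and [(n+1) k], which makes the
    total perturbation small relative to [K], with [k] the number of points. *)
Lemma approximate_numerosity s p (n : nat) :
  exists (nu : set R -> R) (N K : R),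
  [/\ n%:R <= N, 0 < K & [/\
      forall X, 0 <= nu X,
      forall X Y, X `&` Y = set0 -> nu (X `|` Y) = nu X + nu Y,
      forall x, x \in p -> [set x] \in s -> nu [set x] = 1,
      forall a b, a \in p -> b \in p -> a <= b ->
        `[a, b[%classic \in s -> nu `[a, b[%classic = K * (b - a) &
      forall X, lebesgue_measurable X -> X \in s ->
        `|nu X / K - window N X| <= n.+1%:R^-1]].
Proof.
pose ms := [seq X <- s | `[< lebesgue_measurable X >]].
have [c [mc cE]] : exists c : R -> R,
    (forall Y, lebesgue_measurable (c @^-1` Y)) /\
    (forall X, X \in ms -> c @^-1` X = X).
  by apply: representative_map => X; rewrite mem_filter => /andP[/asboolP].
have {}cE X : lebesgue_measurable X -> X \in s -> c @^-1` X = X.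
  by move=> mX Xs; apply: cE; rewrite mem_filter Xs andbT; exact/asboolP.
have [h [h0 hgap]] := min_gap [seq a - e | a <- p, e <- p].
have {}hgap e a : e \in p -> a \in p -> e < a -> e + h <= a.
  move=> ep ap ea; rewrite -lerBrDl; apply: hgap; last by rewrite subr_gt0.
  by apply/allpairsP; exists (a, e).
have [N [nN pN]] := finite_bound p n%:R.
pose E := undup p.
pose k : R := (size E)%:R.
pose K := 1 + k / h + n.+1%:R * k.
have k0 : 0 <= k by rewrite ler0n.
have kh0 : 0 <= k / h by rewrite divr_ge0// ltW.
have nk0 : 0 <= n.+1%:R * k by rewrite mulr_ge0.
have K1 : 1 <= K by rewrite /K -addrA lerDl addr_ge0.
have K0 : 0 < K by exact: lt_le_trans K1.
pose I e := `[e, e + h[%classic.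
pose nu X := K * window N (c @^-1` X) +
  \sum_(e <- E) (\1_X e - window N (c @^-1` X `&` I e) / h).
have wI X e : 0 <= window N (X `&` I e) / h <= 1.
  rewrite divr_ge0 ?window_ge0 ?(ltW h0)//= ler_pdivrMr// mul1r.
  apply: (@le_trans _ _ (window N (I e))); first exact: le_window.
  apply: le_trans (le_window_itv _ _ _ _) _; rewrite ?lerDl ?(ltW h0)//.
  by rewrite addrAC subrr add0r.
have ind01 X (e : R) : 0 <= (\1_X e : R) <= 1.
  by rewrite indicE; case: (_ \in _) => /=; rewrite ?lexx ler01.
exists nu, N, K; split => //; split.
(* the masses removed are at most k / h times the measure *)
- move=> X; rewrite /nu big_split/= sumrN.
  rewrite addrCA addr_ge0//.
    by apply: sumr_ge0 => e _; have /andP[] := ind01 X e.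
  rewrite subr_ge0.
  apply: (@le_trans _ _ (\sum_(e <- E) window N (c @^-1` X) / h)).
    apply: ler_sum => e _; rewrite ler_pM2r ?invr_gt0//.
    by apply: le_window => x [].
  rewrite big_const_seq count_predT iter_addr_0 -mulr_natl -/k.
  rewrite mulrCA mulrC ler_wpM2r ?window_ge0//.
  by rewrite /K addrAC lerDr addr_ge0.
- move=> X Y XY0; have cXY : c @^-1` X `&` c @^-1` Y = set0.
    by rewrite -preimage_setI XY0 preimage_set0.
  rewrite /nu preimage_setU windowU// mulrDr addrACA -big_split/=.
  congr (_ + _); apply: eq_bigr => e _.
  rewrite setIUl windowU//.
  + by rewrite indicU_disjoint// mulrDl opprD addrACA.
  + exact/lebesgue_measurableI/lebesgue_measurable_itv.
  + exact/lebesgue_measurableI/lebesgue_measurable_itv.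
  + by rewrite setIACA cXY set0I.
- move=> x xp xs; rewrite /nu cE//; last exact: lebesgue_measurable_set1.
  rewrite window_set1 mulr0 add0r (bigD1_seq x) ?mem_undup ?undup_uniq//=.
  have w0 e : window N ([set x] `&` I e) = 0.
    by apply/eqP; rewrite eq_le window_ge0 andbT -(window_set1 N x) le_window.
  rewrite w0 mul0r subr0 indicE mem_set// big1 ?addr0// => e ex.
  by rewrite w0 mul0r subr0 indicE memNset// => /= exx; rewrite exx eqxx in ex.
- move=> a b ap bp ab abs.
  have /ler_normlP[Na _] := pN _ ap; have /ler_normlP[_ bN] := pN _ bp.
  have {}Na : - N <= a by rewrite lerNl.
  rewrite /nu cE//; last exact: lebesgue_measurable_itv.
  rewrite window_itv// big_seq big1 ?addr0// => e; rewrite mem_undup => ep.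
  (* I e lies before, after or inside the interval, together with e *)
  have [ae|ea] := leP a e; last first.
    rewrite indicE memNset/=; last by rewrite in_itv/= leNgt ea.
    rewrite (_ : _ `&` _ = set0) ?window0 ?mul0r ?subrr//.
    apply/seteqP; split => x //= []; rewrite !in_itv/=.
    move=> /andP[ax _] /andP[_ /lt_le_trans/(_ (hgap _ _ ep ap ea))].
    by rewrite ltNge ax.
  have [be|eb] := leP b e.
    rewrite indicE memNset/=; last by rewrite in_itv/= ltNge be andbF.
    rewrite (_ : _ `&` _ = set0) ?window0 ?mul0r ?subrr//.
    apply/seteqP; split => x //= []; rewrite !in_itv/=.
    move=> /andP[_ xb] /andP[/(le_trans be) + _].
    by rewrite leNgt xb.
  rewrite indicE mem_set/=; last by rewrite in_itv/= ae.
  have ehb := hgap _ _ ep bp eb.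
  rewrite setIidr; last first.
    move=> x /=; rewrite !in_itv/= => /andP[ex xe].
    by rewrite (le_trans ae ex) (lt_le_trans xe ehb).
  rewrite window_itv ?(le_trans Na)// ?(le_trans ehb)// ?lerDl ?ltW//.
  by rewrite addrAC subrr add0r divff ?subrr// gt_eqF.
(* each point contributes an error between -1 and 1 before division by K *)
- move=> X mX Xs; rewrite /nu cE// mulrDl mulrAC divff ?gt_eqF// mul1r.
  rewrite addrAC subrr add0r normrM normfV (gtr0_norm K0) ler_pdivrMr//.
  apply: (@le_trans _ _ k).
    apply: le_trans (ler_norm_sum _ _ _) _.
    apply: (@le_trans _ _ (\sum_(e <- E) 1)).
      apply: ler_sum => e _; have /andP[? ?] := ind01 X e.
      have /andP[? ?] := wI X e.
      rewrite ler_norml; apply/andP; split.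
        by rewrite -[leLHS]add0r lerD// lerN2.
      by rewrite -[leRHS]subr0 lerD// lerN2.
    by rewrite big_const_seq count_predT iter_addr_0.
  rewrite ler_pdivlMl ?ltr0n// /K addrC lerDl addr_ge0//.
Qed.

End finite_approximation.

(** * Shadows and approximation of Lebesgue measure *)

Section shadow_bounds.
Context {R : realType} (F : superreal R).
Implicit Types (xi : F) (a r : R).

Lemma is_shadow_le xi r a :
  is_shadow xi r -> xi <= of_real F a -> r <= a.
Proof.
move=> xir xia; apply/ler_addgt0Pr => e e0.
have [k _ ke] := near_infty_natSinv_lt (PosNum e0).
have /andP[+ _] := xir k.+1 isT.
rewrite ltrBrDl -(rmorph_nat (of_real F)) -fmorphV -rmorphB.
move=> /lt_le_trans/(_ xia); rewrite (leW_mono (of_real_mono F)) ltrBlDr.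
by move=> /ltW/le_trans; apply; rewrite lerD2l ltW// ke/=.
Qed.

Lemma is_shadow_ge xi r a :
  is_shadow xi r -> of_real F a <= xi -> a <= r.
Proof.
move=> xir xia; apply/ler_addgt0Pr => e e0.
have [k _ ke] := near_infty_natSinv_lt (PosNum e0).
have /andP[_] := xir k.+1 isT.
rewrite ltrBlDl -(rmorph_nat (of_real F)) -fmorphV -rmorphD.
move=> /(le_lt_trans xia); rewrite (leW_mono (of_real_mono F)).
by move=> /ltW/le_trans; apply; rewrite lerD2l ltW// ke/=.
Qed.

Lemma is_shadow_sh xi : finite_elt xi ->
  exists2 r, is_shadow xi r & sh xi = r%:E.
Proof.
move=> fxi; rewrite /sh asboolT//; have [r xir] := is_shadow_ex fxi.
by exists (xget 0 [set r | is_shadow xi r]) => //; exact: (xgetI _ xir).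
Qed.

(** With real bounds on nonnegative elements, finite and infinite shadows are
    handled alike, so measures equal to [+oo] need no separate treatment. *)
Lemma sh_le xi a : 0 <= xi -> xi <= of_real F a -> (sh xi <= a%:E)%E.
Proof.
move=> xi0 xia; have [|r xir ->] := is_shadow_sh xi; last first.
  by rewrite lee_fin; exact: is_shadow_le xia.
exists (Num.bound a).+1 => //.
have a0 : 0 <= a.
  by rewrite -(of_real_mono F) rmorph0; exact: le_trans xia.
apply/andP; split; first by apply: lt_le_trans xi0; rewrite oppr_lt0 ltr0n.
apply: (le_lt_trans xia).
rewrite -(rmorph_nat (of_real F)) (leW_mono (of_real_mono F)).
by apply: lt_trans (archi_boundP a0) _; rewrite ltr_nat.
Qed.

Lemma sh_ge xi a : 0 <= xi -> of_real F a <= xi -> (a%:E <= sh xi)%E.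
Proof.
move=> xi0 axi; have [fxi|nfxi] := pselect (finite_elt xi).
  have [r xir ->] := is_shadow_sh xi fxi.
  by rewrite lee_fin; exact: is_shadow_ge axi.
rewrite /sh asboolF//; case: ltP => [_|xi0']; first exact: leey.
exfalso; apply: nfxi; exists 1 => //.
have -> : xi = 0 by apply/eqP; rewrite eq_le xi0' xi0.
by rewrite oppr_lt0 ltr01.
Qed.

End shadow_bounds.

Lemma ereal_between {R : realType} (x y : \bar R) : (x < y)%E ->
  exists2 a : R, (x < a%:E)%E & (a%:E < y)%E.
Proof.
case: x y => [r| |] [s| |]//=.
- rewrite lte_fin => rs; exists ((r + s) / 2); rewrite lte_fin.
    exact: (midf_lt rs).1.
  exact: (midf_lt rs).2.
- by move=> _; exists (r + 1); rewrite ?ltry// lte_fin ltrDl.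
- by move=> _; exists (s - 1); rewrite ?ltNyr// lte_fin gtrDl oppr_lt0.
- by move=> _; exists 0; rewrite ?ltNyr ?ltry.
Qed.

Section lebesgue_approximation.
Context {R : realType}.
Implicit Types (X : set R).
Local Notation lambda := (@completed_lebesgue_measure R).
Local Notation cara := (caratheodory_type (wlength (idfun : R -> R))^*%mu).

(** Continuity from below, along the windows exhausting the line. *)
Lemma lt_window X (a : R) : lebesgue_measurable X -> (a%:E < lambda X)%E ->
  exists n : nat, forall N, n%:R <= N -> a < window N X.
Proof.
move=> mX aX; pose G (n : nat) : set R := X `&` `[- n%:R, n%:R[%classic.
have mG n : lebesgue_measurable (G n).
  exact: lebesgue_measurableI (lebesgue_measurable_itv _).
have itv_le (r t : R) : r <= t -> `[- r, r[%classic `<=` `[- t, t[%classic.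
  by move=> rt; apply: subset_itv; rewrite bnd_simp// lerN2.
have ndG : nondecreasing_seq G.
  move=> m n mn; apply/subsetPset; apply: setIS.
  by apply: itv_le; rewrite ler_nat.
have UG : \bigcup_n G n = X.
  rewrite -setI_bigcupr; apply/setIidPl => x _.
  exists (Num.bound `|x|) => //=; rewrite in_itv/=.
  have := archi_boundP (normr_ge0 x); rewrite ltr_norml => /andP[h1 h2].
  by rewrite h2 ltW.
have mUG : lebesgue_measurable (\bigcup_n G n) by rewrite UG.
have cvgG : (lambda \o G) n @[n --> \oo] --> lambda X.
  by rewrite -UG; exact: (@nondecreasing_cvg_mu _ cara _ lambda G mG mUG ndG).
have [n _ nG] : \forall n \near \oo, (a%:E < lambda (G n))%E.
  exact: (cvgG _ (open_ereal_gt' aX)).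
exists n => N nN; rewrite -lte_fin fineK ?fin_num_window//.
apply: lt_le_trans (nG n (leqnn n)) _; apply: le_completed_lebesgue.
by apply: setIS; exact: itv_le.
Qed.

(** The union of a cover by intervals that nearly attains the outer measure. *)
Lemma lebesgue_measurable_hull X (a : R) :
  (lebesgue_outer_measure X < a%:E)%E ->
  exists H, [/\ lebesgue_measurable H, X `<=` H & (lambda H < a%:E)%E].
Proof.
move=> /ereal_inf_lt[_ [A [mA XA] <-]] Aa.
exists (\bigcup_k A k); split => //.
  apply: (@bigcupT_measurable _ cara) => k.
  by apply: lebesgue_measurable_borel; exact: sub_sigma_algebra (mA k).
apply: le_lt_trans Aa.
apply: le_trans (outer_measure_sigma_subadditive (wlength idfun)^*%mu A) _.
apply: lee_nneseries => // n _.
by rewrite -(measurable_mu_extE (wlength idfun))//.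
Qed.

End lebesgue_approximation.

(** * The directed set of finite constraints *)

Section stages.
Context {R : realType}.

(** Sets to be measured, points used both as singletons and as endpoints of
    intervals, and a precision that also bounds the window from below. *)
Definition stage : Type := (seq (set R) * seq R * nat)%type.

Definition above (i : stage) : set stage :=
  [set j | {subset i.1.1 <= j.1.1} /\ {subset i.1.2 <= j.1.2} /\
           (i.2 <= j.2)%N].

Definition stage_filter : set_system stage := filter_from setT above.

Lemma stage_filter_proper : ProperFilter stage_filter.
Proof.
apply: filter_from_proper => [|i _]; last by exists i; split => //; split.
apply: filter_fromT_filter; first by exists ([::], [::], 0%N).
move=> i j; exists (i.1.1 ++ j.1.1, i.1.2 ++ j.1.2, maxn i.2 j.2).
move=> k [/= ks [kp kn]]; split; split.
- by move=> X Xi; apply: ks; rewrite mem_cat Xi.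
- split; last exact: leq_trans (leq_maxl _ _) kn.
  by move=> x xi; apply: kp; rewrite mem_cat xi.
- by move=> X Xi; apply: ks; rewrite mem_cat Xi orbT.
- split; last exact: leq_trans (leq_maxr _ _) kn.
  by move=> x xi; apply: kp; rewrite mem_cat xi orbT.
Qed.

Lemma stage_filter_set X : stage_filter [set i | X \in i.1.1].
Proof.
by exists ([:: X], [::], 0%N) => // i [+ _]; apply; rewrite mem_head.
Qed.

Lemma stage_filter_point x : stage_filter [set i | x \in i.1.2].
Proof.
by exists ([::], [:: x], 0%N) => // i [_ [+ _]]; apply; rewrite mem_head.
Qed.

Lemma stage_filter_nat n : stage_filter [set i | (n <= i.2)%N].
Proof. by exists ([::], [::], n) => // i [_ []]. Qed.

End stages.

(** * The numerosity *)

Theorem corollary4p1 (R : realType) :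
  exists (F : superreal R) (nu : set R -> F),
    elementary_numerosity nu /\
    (forall x y a : R, 0 < a ->
      nu `[x, x + a[%classic = nu `[y, y + a[%classic) /\
    (forall (x : R) (a : rat), 0 < a ->
      nu `[x, x + ratr a[%classic =
        of_real F (ratr a) * nu `[0, 1[%classic) /\
    (forall X : set R, lebesgue_measurable X ->
      sh (nu X / nu `[0, 1[%classic) = completed_lebesgue_measure X) /\
    (forall X : set R,
      (sh (nu X / nu `[0%R, 1%R[%classic) <= lebesgue_outer_measure X)%E).
Proof.
have [U [UU GU]] := ultraFilterLemma stage_filter_proper (T := @stage R).
have [nu_ nu_P] :=
  choice (fun i : @stage R => approximate_numerosity i.1.1 i.1.2 i.2).
have [N nuN] := choice nu_P.
have [K {nuN nu_P} nuP] := choice nuN.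
have Uset (X : set R) : \forall i \near U, X \in i.1.1.
  exact/GU/stage_filter_set.
have Upoint (x : R) : \forall i \near U, x \in i.1.2.
  exact/GU/stage_filter_point.
have Unat (n : nat) : \forall i \near U, (n <= i.2)%N.
  exact/GU/stage_filter_nat.
have K_gt0 i : 0 < K i by have [] := nuP i.
have nu_ge0 i X : 0 <= nu_ i X by have [_ _ []] := nuP i.
pose F := @hyper_superreal R _ U UU; pose nu X : F := hclass U (nu_ ^~ X).
have nu_itv (a b : R) : a <= b ->
    nu `[a, b[%classic = of_real F (b - a) * hclass U K.
  move=> ab; rewrite [RHS]hclassM; apply/hclass_eq; near=> i.
  have [_ _ [_ _ _ -> //]] := nuP i; first by rewrite mulrC.
  - by near: i; exact: Upoint.
  - by near: i; exact: Upoint.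
  - by near: i; exact: Uset.
have nu01 : nu `[0, 1[%classic = hclass U K.
  by rewrite nu_itv// subr0 rmorph1 mul1r.
have nuE X : nu X / nu `[0, 1[%classic = hclass U (fun i => nu_ i X / K i).
  by rewrite nu01 /nu [_^-1]hclassV [LHS]hclassM.
have ratio_ge0 X : 0 <= nu X / nu `[0, 1[%classic.
  rewrite nuE; apply/hclass_le; near=> i.
  by rewrite divr_ge0// ltW.
have outer X :
    (sh (nu X / nu `[0%R, 1%R[%classic) <= lebesgue_outer_measure X)%E.
  apply/lee_addgt0Pr => e e0.
  have [->|Xoo] := eqVneq (lebesgue_outer_measure X) +oo%E.
    by rewrite addye// leey.
  have Xfin : lebesgue_outer_measure X \is a fin_num.
    rewrite ge0_fin_numE ?ltey//; exact: outer_measure_ge0.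
  rewrite -(fineK Xfin) -EFinD; set r := fine _.
  have [|H [mH XH Hr]] := @lebesgue_measurable_hull _ X (r + e / 2).
    by rewrite -(fineK Xfin) lte_fin ltrDl divr_gt0.
  apply: sh_le; first exact: ratio_ge0.
  rewrite nuE; apply/hclass_le.
  have e20 : 0 < e / 2 by rewrite divr_gt0.
  have [k _ ke] := near_infty_natSinv_lt (PosNum e20).
  near=> i.
  have [_ _ [_ nuU _ _ /(_ _ mH)]] := nuP i.
  have Hi : H \in i.1.1 by near: i; exact: Uset.
  move=> /(_ Hi); rewrite ler_distl => /andP[_ nuH].
  have nuXH : nu_ i X <= nu_ i H.
    by rewrite -(setDUK XH) nuU ?lerDl// setDIK.
  apply: (@le_trans _ _ (nu_ i H / K i)).
    by rewrite ler_pM2r// invr_gt0.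
  apply: (le_trans nuH); rewrite [e]splitr addrA lerD//.
    rewrite -lee_fin fineK ?fin_num_window//.
    by apply: le_trans (ltW Hr); apply: le_completed_lebesgue => x [].
  apply/ltW/ke => /=; near: i; exact: Unat.
exists F, nu.
split; first split; last split; last split; last (split; last exact: outer).
- by move=> X; apply/hclass_le; near=> i; exact: nu_ge0.
- move=> x; apply/hclass_eq; near=> i.
  have [_ _ [_ _ -> //]] := nuP i.
  - by near: i; exact: Upoint.
  - by near: i; exact: Uset.
- move=> X Y XY0; rewrite [RHS]hclassD; apply/hclass_eq; near=> i.
  by have [_ _ [_ ->]] := nuP i.
- move=> x y a a0; rewrite !nu_itv ?lerDl ?(ltW a0)//.
  by rewrite (addrAC x) (addrAC y) !subrr !add0r.
- move=> x a a0; rewrite nu01 nu_itv ?lerDl ?ler0q ?(ltW a0)//.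
  by rewrite addrAC subrr add0r.
- move=> X mX; apply/eqP; rewrite eq_le outer/=.
  rewrite leNgt; apply/negP => shX.
  (* b leaves room for the error 1/(n+1) of a stage: a <= b - 1/(n+1) *)
  have [a sha aX] := ereal_between _ _ shX.
  have [b ab bX] := ereal_between _ _ aX; rewrite lte_fin in ab.
  have [n nX] := lt_window X b mX bX.
  have ba0 : 0 < b - a by rewrite subr_gt0.
  have [k _ ke] := near_infty_natSinv_lt (PosNum ba0).
  suff /(sh_ge F _ a (ratio_ge0 X)) : of_real F a <= nu X / nu `[0, 1[%classic.
    by rewrite leNgt sha.
  rewrite nuE; apply/hclass_le; near=> i.
  have [nN _ [_ _ _ _ /(_ _ mX)]] := nuP i.
  have Xi : X \in i.1.1 by near: i; exact: Uset.
  move=> /(_ Xi); rewrite ler_distl => /andP[+ _]; apply: le_trans.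
  rewrite lerBrDr; apply: (@le_trans _ _ b).
    rewrite -lerBrDl; apply/ltW/ke => /=; near: i; exact: Unat.
  apply/ltW/nX; apply: le_trans nN; rewrite ler_nat; near: i; exact: Unat.
Unshelve. all: by end_near.
Qed.
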